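(* Let $\phi:G\times Q\to Q$ be an action of a Lie group $G$ on $Q$ such that $\phi_g^*\eta=\eta$ for all $g\in G$, and let $h:V^*\Pi\to T^*Q$ be a Hamiltonian section of $\mu$. Then $h$ is $G$-equivariant, i.e. $T_g^*\phi\circ h=h\circ V_g^*\phi$ for all $g\in G$, if and only if the Hamiltonian function $F_h:T^*Q\to\mathbb R$ induced by $h$ is $G$-invariant, i.e. $F_h\circ T_g^*\phi=F_h$ for all $g\in G$.
   Context: $Q$ is a connected smooth manifold of dimension $n+1$, $\Pi:Q\to\mathbb R$ is a fibration (surjective submersion), $\eta=\Pi^*(dt)\in\Omega^1(Q)$, and $V\Pi=\{u\in TQ\mid\eta(u)=0\}$ is the vertical bundle, with dual bundle $V^*\Pi$. $\mu:T^*Q\to V^*\Pi$ is the dual map of the inclusion $V\Pi\hookrightarrow TQ$ (restriction of covectors to $V\Pi$); it is a principal $\mathbb R$-bundle with action $\psi(s,\alpha_q)=\alpha_q+s\,\eta(q)$. A Hamiltonian section is a smooth section $h$ of $\mu$; the induced function $F_h:T^*Q\to\mathbb R$ is determined by $\alpha_q-h(\mu(\alpha_q))=F_h(\alpha_q)\eta(q)$ for all $\alpha_q\in T_q^*Q$, $q\in Q$. $T^*\phi$ is defined by $(T_g^*\phi(\alpha_q))(u)=\alpha_q(T_{\phi_g(q)}\phi_{g^{-1}}(u))$ for $g\in G$, $\alpha_q\in T_q^*Q$, $u\in T_{\phi_g(q)}Q$. Since $\eta$ is $G$-invariant, the tangent lift $T\phi$ restricts to $V\Pi$, and $V^*\phi$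 is the dual action on $V^*\Pi$: $(V_g^*\phi(\beta_q))(u)=\beta_q(T_{\phi_g(q)}\phi_{g^{-1}}(u))$ for $\beta_q\in V_q^*\Pi$, $u\in V_{\phi_g(q)}\Pi$. *)

(* Defs.v *)
From HB Require Import structures.
From mathcomp Require Import all_boot all_order all_algebra.
From mathcomp Require Import all_classical all_reals.
From mathcomp Require Import topology normedtype landau derive.
Set Implicit Arguments.
Unset Strict Implicit.
Unset Printing Implicit Defensive.
Import Order.TTheory GRing.Theory Num.Theory.
Import numFieldNormedType.Exports.
Local Open Scope classical_set_scope.
Local Open Scope ring_scope.

Section Smooth.
Context {R : realType}.

(** Class C^k on an open set: continuity for [k = 0], and, for [k.+1],
    differentiability with all directional derivatives of class C^k. *)
Fixpoint Ck (k m : nat) (U : set 'rV[R]_m) (f : 'rV[R]_m -> R) : Prop :=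
  match k with
  | 0 => forall x, U x -> {for x, continuous f}
  | k'.+1 => (forall x, U x -> differentiable f x) /\
             (forall v, Ck k' U (fun x => 'd f x v))
  end.

Definition Coo m (U : set 'rV[R]_m) (f : 'rV[R]_m -> R) : Prop :=
  forall k, Ck k U f.

Definition Coo_vec m l (U : set 'rV[R]_m) (F : 'rV[R]_m -> 'rV[R]_l) : Prop :=
  forall i, Coo U (fun x => F x 0 i).

Lemma CkW k m (U : set 'rV[R]_m) f : Ck k.+1 U f -> Ck k U f.
Proof.
elim: k f => [|k IH] f [df Df] /=.
  by move=> x Ux; apply: differentiable_continuous; exact: df.
by split=> // v; apply: IH; exact: Df.
Qed.

Lemma Ck_sub k m (U W : set 'rV[R]_m) f : W `<=` U -> Ck k U f -> Ck k W f.
Proof.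
move=> WU; elim: k f => [|k IH] f /=; first by move=> H x /WU; exact: H.
by move=> [df Df]; split=> [x /WU|v]; [exact: df|exact: IH].
Qed.

Lemma Ck_loc k m (U : set 'rV[R]_m) f :
  (forall x, U x -> exists2 W : set 'rV[R]_m, W x & Ck k W f) -> Ck k U f.
Proof.
elim: k f => [|k IH] f H /=.
  by move=> x /H[W Wx]; apply.
split=> [x /H[W Wx [df _]]|v]; first exact: df.
by apply: IH => x /H[W Wx [_ Df]]; exists W => //; exact: Df.
Qed.

Lemma near_diff m (f g : 'rV[R]_m -> R) x :
  (\forall y \near x, f y = g y) -> differentiable f x ->
  differentiable g x /\ (forall v, 'd g x v = 'd f x v).
Proof.
move=> fg df.
have fgx : f x = g x by exact: nbhs_singleton fg.
have H : g \o shift x = cst (g x) + ('d f x : _ -> _) +o_ 0 id.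
  have fg0 : \forall y \near 0, f (y + x) = g (y + x).
    by move: fg; rewrite (near_shift 0); apply: filterS => y /=; rewrite subr0.
  apply/eqaddoP => e e0.
  have /eqaddoP/(_ e e0) F := diff_locally df.
  near=> y.
  suff -> : (g \o shift x - (cst (g x) + ('d f x : _ -> _))) y =
            (f \o shift x - (cst (f x) + ('d f x : _ -> _))) y by near: y.
  rewrite !fctE /= fgx; congr (_ - _); symmetry; near: y; exact: fg0.
have dE : 'd g x = 'd f x :> (_ -> _) by apply: diff_unique H; exact: diff_continuous.
split=> [|v]; last exact: (congr1 (@^~ v) dE).
apply/diff_locallyP; rewrite dE; split; [exact: diff_continuous|exact: H].
Unshelve. all: by end_near. Qed.

Lemma Ck_ext k m (U : set 'rV[R]_m) (f g : 'rV[R]_m -> R) :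
  open U -> (forall x, U x -> f x = g x) -> Ck k U f -> Ck k U g.
Proof.
move=> oU.
have nfg (p q : 'rV[R]_m -> R) : (forall x, U x -> p x = q x) ->
    forall x, U x -> \forall y \near x, p y = q y.
  move=> pq x Ux; near=> y; apply: pq; near: y; exact: open_nbhs_nbhs.
elim: k f g => [|k IH] f g fg /=.
  move=> cf x Ux; change (g @ x --> g x); rewrite -(fg x Ux).
  apply: cvg_trans (cf x Ux); apply: (@near_eq_cvg _ _ _ (nbhs_filter x)).
  by apply: (nfg _ _ _ x Ux) => y Uy; rewrite fg.
move=> [df Df]; split=> [x Ux|v].
  exact: (near_diff (nfg _ _ fg x Ux) (df x Ux)).1.
apply: IH (Df v) => x Ux.
exact: esym ((near_diff (nfg _ _ fg x Ux) (df x Ux)).2 v).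
Unshelve. all: by end_near. Qed.

Lemma diffDv m (f g : 'rV[R]_m -> R) x v :
  differentiable f x -> differentiable g x ->
  'd (fun y => f y + g y) x v = 'd f x v + 'd g x v.
Proof. by move=> df dg; exact: (congr1 (@^~ v) (diffD df dg)). Qed.

Lemma diffMv m (f g : 'rV[R]_m -> R) x v :
  differentiable f x -> differentiable g x ->
  'd (fun y => f y * g y) x v = f x * 'd g x v + g x * 'd f x v.
Proof. by move=> df dg; exact: (congr1 (@^~ v) (diffM df dg)). Qed.

Lemma diff_cstE m (r : R) (x v : 'rV[R]_m) :
  'd (fun _ : 'rV[R]_m => r) x v = 0.
Proof. exact: (congr1 (@^~ v) (diff_cst (r : R^o) x)). Qed.

Lemma Ck_cst k m (U : set 'rV[R]_m) (c : R) : Ck k U (fun=> c).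
Proof.
elim: k c => [|k IH] c /=; first by move=> x _; exact: cst_continuous.
split=> [x _|v]; first exact: differentiable_cst.
have -> : (fun x => 'd (fun _ : 'rV[R]_m => c) x v) = fun=> 0.
  by apply/funext => x; exact: diff_cstE.
exact: IH.
Qed.

Lemma Ck_add k m (U : set 'rV[R]_m) (f g : 'rV[R]_m -> R) : open U ->
  Ck k U f -> Ck k U g -> Ck k U (fun x => f x + g x).
Proof.
move=> oU; elim: k f g => [|k IH] f g /=.
  by move=> cf cg x Ux; apply: continuousD; [exact: cf|exact: cg].
move=> [df Df] [dg Dg]; split=> [x Ux|v].
  by apply: differentiableD; [exact: df|exact: dg].
apply: Ck_ext (IH _ _ (Df v) (Dg v)) => // x Ux.
exact: esym (diffDv _ (df _ Ux) (dg _ Ux)).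
Qed.

Lemma Ck_mul k m (U : set 'rV[R]_m) (f g : 'rV[R]_m -> R) : open U ->
  Ck k U f -> Ck k U g -> Ck k U (fun x => f x * g x).
Proof.
move=> oU; elim: k f g => [|k IH] f g.
  by move=> cf cg x Ux; apply: continuousM; [exact: cf|exact: cg].
move=> Cf Cg; have [/= [df Df] [dg Dg]] := (Cf, Cg); split=> [x Ux|v].
  by apply: differentiableM; [exact: df|exact: dg].
have H := Ck_add oU (IH _ _ (CkW Cf) (Dg v)) (IH _ _ (CkW Cg) (Df v)).
apply: Ck_ext H => // x Ux.
exact: esym (diffMv _ (df _ Ux) (dg _ Ux)).
Qed.

Lemma Ck_sum k m (U : set 'rV[R]_m) n (f : 'I_n -> 'rV[R]_m -> R) : open U ->
  (forall i, Ck k U (f i)) -> Ck k U (fun x => \sum_i f i x).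
Proof.
move=> oU; elim: n f => [|n IH] f Cf.
  by under eq_fun do rewrite big_ord0; exact: Ck_cst.
under eq_fun do rewrite big_ord_recl; apply: Ck_add => //.
by apply: IH => i; exact: Cf.
Qed.

Lemma diff_coordE m (i : 'I_m) (x v : 'rV[R]_m) :
  'd (fun y : 'rV[R]_m => y 0 i : R) x v = v 0 i.
Proof.
have @f : {linear 'rV[R]_m -> R}.
  by exists (fun N : 'rV[R]_m => N 0 i); do 2![eexists]; do ?[constructor];
     rewrite ?mxE// => ? *; rewrite ?mxE//; move=> ?; rewrite !mxE.
by rewrite (_ : (fun _ => _) = f) // diff_lin //; exact: coord_continuous.
Qed.

Lemma Ck_coord k m (U : set 'rV[R]_m) i : Ck k U (fun x => x 0 i).
Proof.
case: k => [|k] /=; first by move=> x _; exact: coord_continuous.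
split=> [x _|v]; first exact: differentiable_coord.
have -> : (fun x => 'd (fun y : 'rV[R]_m => y 0 i : R) x v) = fun=> v 0 i.
  by apply/funext => x; exact: diff_coordE.
exact: Ck_cst.
Qed.

Lemma rV_sum l (y : 'rV[R]_l) : y = \sum_i y 0 i *: delta_mx 0 i.
Proof. exact: row_sum_delta. Qed.

Lemma diff_coords m l (F : 'rV[R]_m -> 'rV[R]_l) x :
  (forall i, differentiable (fun x => F x 0 i : R) x) ->
  differentiable F x /\
  forall v, 'd F x v = \sum_i 'd (fun x => F x 0 i : R) x v *: delta_mx 0 i.
Proof.
move=> dF.
have FE : F = \sum_i (fun x => F x 0 i *: (delta_mx 0 i : 'rV[R]_l)).
  by apply/funext => y; rewrite fct_sumE; exact: rV_sum.
have dF' : differentiable F x.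
  rewrite FE; apply: differentiable_sum => i.
  by apply: (@differentiableZl _ _ _ (fun x => F x 0 i : R)).
split=> // v; rewrite (rV_sum ('d F x v)); apply: eq_bigr => i _; congr (_ *: _).
have -> : (fun x => F x 0 i : R) = (fun y : 'rV[R]_l => y 0 i) \o F by [].
have dc : differentiable (fun y : 'rV[R]_l => y 0 i) (F x) by exact: differentiable_coord.
by rewrite (diff_comp dF' dc) /= diff_coordE.
Qed.

Lemma Ck_comp k m l (U : set 'rV[R]_m) (W : set 'rV[R]_l)
    (F : 'rV[R]_m -> 'rV[R]_l) (f : 'rV[R]_l -> R) :
  open U -> Coo_vec U F -> (forall x, U x -> W (F x)) -> Ck k W f ->
  Ck k U (fun x => f (F x)).
Proof.
move=> oU CF FUW.
have dFi x i : U x -> differentiable (fun x => F x 0 i : R) x.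
  by move=> Ux; have [dF _] := CF i 1%N; exact: dF.
have dF x : U x -> differentiable F x.
  by move=> Ux; apply: (diff_coords _).1 => i; exact: dFi.
elim: k f => [|k IH] f /=.
  move=> cf x Ux; apply: continuous_comp; last by apply: cf; exact: FUW.
  by apply: differentiable_continuous; exact: dF.
move=> [df Df]; split=> [x Ux|v].
  by apply: differentiable_comp; [exact: dF|apply: df; exact: FUW].
have H : Ck k U (fun x => \sum_i 'd (fun x => F x 0 i : R) x v *
                                'd f (F x) (delta_mx 0 i)).
  apply: Ck_sum => // i; apply: Ck_mul => //.
    by have [_ D] := CF i k.+1; exact: D.
  by apply: (IH (fun y => 'd f y (delta_mx 0 i))); exact: Df.
apply: Ck_ext H => // x Ux.
transitivity ('d f (F x) ('d F x v)).
  rewrite (diff_coords (fun i => dFi x i Ux)).2 linear_sum.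
  by apply: eq_bigr => i _; rewrite linearZ.
exact: esym (congr1 (@^~ v) (diff_comp (dF _ Ux) (df _ (FUW _ Ux)))).
Qed.

Lemma Coo_comp m l (U : set 'rV[R]_m) (W : set 'rV[R]_l)
    (F : 'rV[R]_m -> 'rV[R]_l) (f : 'rV[R]_l -> R) :
  open U -> Coo_vec U F -> (forall x, U x -> W (F x)) -> Coo W f ->
  Coo U (fun x => f (F x)).
Proof. by move=> oU CF FUW Cf k; exact: Ck_comp (Cf k). Qed.

End Smooth.

Record chart (R : realType) (m : nat) (M : Type) := Chart {
  cdom : set M ;
  cval :> M -> 'rV[R]_m }.

Section Charts.
Context {R : realType}.

(** [via c f] is [f \o c^-1] on the image of [c] (and [0] elsewhere). *)
Definition via m (M : Type) (V : nmodType) (c : chart R m M) (f : M -> V)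
  : 'rV[R]_m -> V :=
  fun x => xget 0 (f @` (cdom c `&` c @^-1` [set x])).

Lemma viaE m M (V : nmodType) (c : chart R m M) (f : M -> V) p :
  {in cdom c &, injective c} -> cdom c p -> via c f (c p) = f p.
Proof.
move=> ic cp; rewrite /via; case: xgetP => [_ -> [q [cq /= qp]]|].
  by move=> <-; rewrite (ic q p) // inE.
by move=> /(_ (f p)) []; exists p.
Qed.

(** Smoothness of a map read in a chart of its source and a chart of its target;
    openness of the domain of the local expression encodes continuity. *)
Definition smooth_in m l (M N : Type) (a : chart R m M) (b : chart R l N)
    (f : M -> N) : Prop :=
  let W := a @` (cdom a `&` f @^-1` cdom b) in
  open W /\ Coo_vec W (via a (b \o f)).

Definition smooth_wrt m l (M N : Type) (A : set (chart R m M))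
    (B : set (chart R l N)) (f : M -> N) : Prop :=
  forall a b, A a -> B b -> smooth_in a b f.

(** A homeomorphism from an open subset of [M] onto an open subset of [R^m]. *)
Definition is_chart m (M : topologicalType) (c : chart R m M) : Prop :=
  [/\ open (cdom c), {in cdom c &, injective c},
      forall p, cdom c p -> {for p, continuous c}
    & forall W, open W -> W `<=` cdom c -> open (c @` W)].

Definition compatible m (M : Type) (a b : chart R m M) : Prop :=
  smooth_in a b id /\ smooth_in b a id.

Definition prod_chart m l (M N : Type) (a : chart R m M) (b : chart R l N)
  : chart R (m + l) (M * N) :=
  {| cdom := cdom a `*` cdom b ;
     cval := fun p => row_mx (a p.1) (b p.2) |}.

Definition prod_atlas m l (M N : Type) (A : set (chart R m M))
    (B : set (chart R l N)) : set (chart R (m + l) (M * N)) :=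
  [set c | exists2 a, A a & exists2 b, B b & c = prod_chart a b].

End Charts.

HB.mixin Record isManifold (R : realType) (m : nat) M of Topological M := {
  atlas : set (chart R m M) ;
  atlas_chart : forall a, atlas a -> is_chart a ;
  atlas_cover : forall p : M, exists2 a, atlas a & cdom a p ;
  atlas_compat : forall a b, atlas a -> atlas b -> compatible a b ;
  manifold_hausdorff : hausdorff_space M ;
  manifold_second_countable : @second_countable M }.

#[short(type="manifoldType")]
HB.structure Definition Manifold (R : realType) (m : nat) :=
  {M of isManifold R m M & Topological M}.

Definition smooth_map (R : realType) m l (M : manifoldType R m)
    (N : manifoldType R l) (f : M -> N) : Prop :=
  smooth_wrt (@atlas R m M) (@atlas R l N) f.

HB.mixin Record isLieGroup (R : realType) (m : nat) G
    of Manifold R m G & Group G := {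
  mulg_smooth : smooth_wrt (prod_atlas (@atlas R m G) (@atlas R m G))
    (@atlas R m G) (fun p : G * G => (p.1 * p.2)%g) ;
  invg_smooth : @smooth_map R m m G G (fun g : G => g^-1%g) }.

#[short(type="lieGroupType")]
HB.structure Definition LieGroup (R : realType) (m : nat) :=
  {G of isLieGroup R m G & Manifold R m G & Group G}.

Definition max_atlas (R : realType) m (M : manifoldType R m)
  : set (chart R m M) :=
  [set c | is_chart c /\ forall a, @atlas R m M a -> compatible a c].
Arguments max_atlas {R m} M.

Definition is_smooth (R : realType) m (M : manifoldType R m)
  : {pred M -> R} :=
  fun f => `[< forall a, @atlas R m M a -> Coo (a @` cdom a) (via a f) >].
Arguments is_smooth {R m} M.

Record smooth_fun (R : realType) m (M : manifoldType R m) := SmoothFun {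
  sval_fun :> M -> R ;
  smooth_funP : sval_fun \in is_smooth M }.

Section SmoothFun.
Context {R : realType} {m : nat} {M : manifoldType R m}.

Lemma is_smoothP (f : M -> R) : f \in is_smooth M <->
  forall a, @atlas R m M a -> Coo (a @` cdom a) (via a f).
Proof. by split=> [/asboolP|H]; last exact/asboolP. Qed.

Lemma is_chart_img (c : chart R m M) : is_chart c -> open (c @` cdom c).
Proof. by case=> oc _ _; apply. Qed.

Lemma Ck_via2 (c : chart R m M) (op : R -> R -> R) (f g : M -> R) k :
  is_chart c ->
  Ck k (c @` cdom c) (fun x => op (via c f x) (via c g x)) ->
  Ck k (c @` cdom c) (via c (fun p => op (f p) (g p))).
Proof.
move=> cc; have [_ ic _ _] := cc.
apply: Ck_ext; first exact: is_chart_img.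
by move=> _ [p cp <-]; rewrite !viaE.
Qed.

Lemma is_smooth_cst (r : R) : (fun=> r) \in is_smooth M.
Proof.
apply/is_smoothP => a /atlas_chart ac k; have [_ ia _ _] := ac.
apply: Ck_ext (Ck_cst k _ r); first exact: is_chart_img.
by move=> _ [p cp <-]; rewrite viaE.
Qed.

Lemma is_smooth_mul (f g : M -> R) : f \in is_smooth M -> g \in is_smooth M ->
  (fun p => f p * g p) \in is_smooth M.
Proof.
move=> /is_smoothP Hf /is_smoothP Hg; apply/is_smoothP => a Aa k.
have ac := atlas_chart a Aa; apply: (Ck_via2 (op := fun x y => x * y)) => //.
by apply: Ck_mul; [exact: is_chart_img|exact: Hf|exact: Hg].
Qed.

Lemma is_smooth_add (f g : M -> R) : f \in is_smooth M -> g \in is_smooth M ->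
  (fun p => f p + g p) \in is_smooth M.
Proof.
move=> /is_smoothP Hf /is_smoothP Hg; apply/is_smoothP => a Aa k.
have ac := atlas_chart a Aa; apply: (Ck_via2 (op := fun x y => x + y)) => //.
by apply: Ck_add; [exact: is_chart_img|exact: Hf|exact: Hg].
Qed.

Fact is_smooth_subring : subring_closed (is_smooth M).
Proof.
split=> [|f g Hf Hg|f g Hf Hg]; first exact: is_smooth_cst.
  rewrite (_ : f - g = fun p => f p + (-1) * g p); last first.
    by apply/funext => p; rewrite mulN1r.
  exact: (is_smooth_add Hf (is_smooth_mul (is_smooth_cst (-1)) Hg)).
exact: (is_smooth_mul Hf Hg).
Qed.

Fact is_smooth_submod : submod_closed (is_smooth M).
Proof.
split=> [|r f g Hf Hg]; first exact: is_smooth_cst.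
exact: (is_smooth_add (is_smooth_mul (is_smooth_cst r) Hf) Hg).
Qed.

End SmoothFun.

HB.instance Definition _ R m (M : manifoldType R m) :=
  GRing.isSubringClosed.Build (M -> R) (is_smooth M) is_smooth_subring.
HB.instance Definition _ R m (M : manifoldType R m) :=
  GRing.isSubmodClosed.Build R (M -> R) (is_smooth M) is_smooth_submod.

HB.instance Definition _ R m (M : manifoldType R m) :=
  [isSub for @sval_fun R m M].
HB.instance Definition _ R m (M : manifoldType R m) :=
  [Choice of smooth_fun M by <:].
HB.instance Definition _ R m (M : manifoldType R m) :=
  GRing.SubChoice_isSubComPzRing.Build (M -> R) (is_smooth M) (smooth_fun M)
    is_smooth_subring.
HB.instance Definition _ R m (M : manifoldType R m) :=
  GRing.SubZmodule_isSubLmodule.Build R (M -> R) (is_smooth M) (smooth_fun M)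
    is_smooth_submod.

Section Pullback.
Context {R : realType}.

Lemma Coo_via_comp m l (M N : Type) (a : chart R m M) (b : chart R l N)
    (f : M -> N) (g : N -> R) :
  {in cdom a &, injective a} -> {in cdom b &, injective b} -> smooth_in a b f ->
  Coo (b @` cdom b) (via b g) ->
  Coo (a @` (cdom a `&` f @^-1` cdom b)) (via a (g \o f)).
Proof.
move=> ia ib [oW sf] sg k.
have H : Coo (a @` (cdom a `&` f @^-1` cdom b))
    (fun x => via b g (via a (b \o f) x)).
  apply: (Coo_comp oW sf _ sg) => _ [p [ap bp] <-].
  by rewrite viaE //; exists (f p).
apply: (Ck_ext oW _ (H k)) => _ [p [ap bp] <-].
by rewrite !viaE.
Qed.

Lemma smooth_pull m l (M : manifoldType R m) (N : manifoldType R l)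
    (f : M -> N) (g : N -> R) :
  smooth_map f -> g \in is_smooth N -> g \o f \in is_smooth M.
Proof.
move=> sf /is_smoothP sg; apply/is_smoothP => a Aa k.
have [_ ia _ _] := atlas_chart a Aa.
apply: Ck_loc => _ [p ap <-].
have [b Bb bp] := atlas_cover (f p); have [_ ib _ _] := atlas_chart b Bb.
exists (a @` (cdom a `&` f @^-1` cdom b)); first by exists p.
exact: (Coo_via_comp ia ib (sf a b Aa Bb) (sg b Bb)).
Qed.

Definition pull m l (M : manifoldType R m) (N : manifoldType R l) (f : M -> N)
    (sf : smooth_map f) (g : smooth_fun N) : smooth_fun M :=
  SmoothFun (smooth_pull sf (smooth_funP g)).

Lemma smooth_fun_inj m (M : manifoldType R m) (f g : smooth_fun M) :
  (forall p, f p = g p) -> f = g.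
Proof. by move=> fg; apply: val_inj; apply/funext. Qed.

Lemma Coo_max_atlas m (M : manifoldType R m) (c : chart R m M)
    (f : smooth_fun M) : max_atlas M c -> Coo (c @` cdom c) (via c f).
Proof.
move=> [cc cA] k; have [_ ic _ _] := cc; apply: Ck_loc => _ [p cp <-].
have [a Aa ap] := atlas_cover p; have [_ ia _ _] := atlas_chart a Aa.
exists (c @` (cdom c `&` id @^-1` cdom a)); first by exists p.
have /is_smoothP sf := smooth_funP f.
exact: (Coo_via_comp ic ia (cA a Aa).2 (sf a Aa)).
Qed.

End Pullback.

Definition is_tangent (R : realType) m (M : manifoldType R m) (p : M)
  : {pred smooth_fun M -> R} :=
  fun v => `[< (forall (r : R) f g, v (r *: f + g) = r * v f + v g) /\
               (forall f g, v (f * g) = f p * v g + g p * v f) >].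

Record tangent (R : realType) m (M : manifoldType R m) (p : M) := Tangent {
  tangent_val :> smooth_fun M -> R ;
  tangentP : tangent_val \in is_tangent p }.

Section Tangent.
Context {R : realType} {m : nat} {M : manifoldType R m}.

Lemma is_tangentP (p : M) (v : smooth_fun M -> R) : v \in is_tangent p <->
  (forall (r : R) f g, v (r *: f + g) = r * v f + v g) /\
  (forall f g, v (f * g) = f p * v g + g p * v f).
Proof. by split=> [/asboolP|H]; last exact/asboolP. Qed.

Fact is_tangent_submod (p : M) : submod_closed (is_tangent p).
Proof.
split=> [|r u v /is_tangentP[lu du] /is_tangentP[lv dv]]; apply/is_tangentP.
  by split=> *; rewrite !mulr0 addr0.
split=> [s f g|f g].
  rewrite -![(r *: u + v) _]/(r * u _ + v _) lu lv !mulrDr !mulrA (mulrC s r).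
  by rewrite addrACA.
rewrite -![(r *: u + v) _]/(r * u _ + v _) du dv !mulrDr !mulrA.
by rewrite !(mulrC (_ p) r) addrACA.
Qed.

End Tangent.

HB.instance Definition _ R m (M : manifoldType R m) (p : M) :=
  GRing.isSubmodClosed.Build R (smooth_fun M -> R) (is_tangent p)
    (is_tangent_submod p).
HB.instance Definition _ R m (M : manifoldType R m) (p : M) :=
  [isSub for @tangent_val R m M p].
HB.instance Definition _ R m (M : manifoldType R m) (p : M) :=
  [Choice of tangent p by <:].
HB.instance Definition _ R m (M : manifoldType R m) (p : M) :=
  [SubChoice_isSubLmodule of tangent p by <:].

Section TangentMap.
Context {R : realType} {m l : nat} {M : manifoldType R m} {N : manifoldType R l}.
Variables (f : M -> N) (sf : smooth_map f) (p : M) (q : N) (e : f p = q).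

Fact tmap_subproof (v : tangent p) :
  (fun g => v (pull sf g)) \in is_tangent q.
Proof.
have /is_tangentP[lv dv] := tangentP v; apply/is_tangentP; split=> [r g h|g h].
  by rewrite -lv; congr (v _); apply: smooth_fun_inj.
rewrite (_ : pull sf (g * h) = pull sf g * pull sf h) ?dv /= ?e //.
exact: smooth_fun_inj.
Qed.

(** The tangent map [T_p f : T_p M -> T_(f p) N]; the codomain is given as [T_q N]
    with a proof of [f p = q]. *)
Definition tmap (v : tangent p) : tangent q := Tangent (tmap_subproof v).

Fact tmap_is_linear : linear tmap.
Proof. by move=> r u v; apply: val_inj; apply/funext. Qed.

HB.instance Definition _ :=
  GRing.isLinear.Build R (tangent p) (tangent q) _ tmap tmap_is_linear.

End TangentMap.

(** The vector [d/dx^i] at [p] in the chart [c]: it is meant for [c] in the maximal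
    atlas and [p] in its domain, where [coord_vecE] characterizes it. *)
Definition coord_vec (R : realType) m (M : manifoldType R m) (c : chart R m M)
    (p : M) (i : 'I_m) : tangent p :=
  xget 0 [set v : tangent p |
    forall f : smooth_fun M, v f = 'd (via c f) (c p) (delta_mx 0 i)].

Lemma coord_vecE (R : realType) m (M : manifoldType R m) (c : chart R m M)
    (p : M) (i : 'I_m) (f : smooth_fun M) :
  max_atlas M c -> cdom c p ->
  coord_vec c p i f = 'd (via c f) (c p) (delta_mx 0 i).
Proof.
move=> Mc cp; have [cc _] := Mc; have [_ ic _ _] := cc.
pose V := c @` cdom c; have Vp : V (c p) by exists p.
have oV : open V by exact: is_chart_img.
have nV : \forall x \near c p, V x by exact: open_nbhs_nbhs.
have dvia (g : smooth_fun M) : differentiable (via c g) (c p).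
  by have [D _] := Coo_max_atlas g Mc 1%N; exact: D.
pose v (g : smooth_fun M) := 'd (via c g) (c p) (delta_mx 0 i).
have vop (op : R -> R -> R) (g h k : smooth_fun M) :
    (forall q, k q = op (g q) (h q)) ->
    differentiable (fun x => op (via c g x) (via c h x)) (c p) ->
    v k = 'd (fun x => op (via c g x) (via c h x)) (c p) (delta_mx 0 i).
  move=> kE D; apply: (near_diff _ D).2; apply: filterS nV => _ [q cq <-].
  by rewrite !viaE.
have vT : v \in is_tangent p.
  apply/is_tangentP; split=> [r g h|g h].
    have dr : differentiable (fun x : 'rV[R]_m => r) (c p).
      exact: differentiable_cst.
    have drg : differentiable (fun x => r * via c g x) (c p).
      exact: (differentiableM dr (dvia g)).
    rewrite (vop (fun x y => r * x + y) g h) //; last first.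
      exact: (differentiableD drg (dvia h)).
    rewrite (diffDv _ drg (dvia h)) (diffMv _ dr (dvia g)) diff_cstE.
    by rewrite mulr0 addr0.
  rewrite (vop (fun x y => x * y) g h) //; last first.
    exact: (differentiableM (dvia g) (dvia h)).
  by rewrite (diffMv _ (dvia g) (dvia h)) !viaE.
rewrite /coord_vec; case: xgetP => [w _ wP|noV]; first exact: wP.
by have [] := noV (Tangent vT).
Qed.

Definition is_form (R : realType) (V : lmodType R) : {pred V -> R} :=
  fun a => `[< forall (r : R) u v, a (r *: u + v) = r * a u + a v >].
Arguments is_form {R} V.

Record dual (R : realType) (V : lmodType R) := Dual {
  dual_val :> V -> R ;
  dualP : dual_val \in is_form V }.

Section Dual.
Context {R : realType}.

Lemma is_formP (V : lmodType R) (a : V -> R) : a \in is_form V <->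
  forall (r : R) u v, a (r *: u + v) = r * a u + a v.
Proof. by split=> [/asboolP|H]; last exact/asboolP. Qed.

Fact is_form_submod (V : lmodType R) : submod_closed (is_form V).
Proof.
split=> [|r a b /is_formP la /is_formP lb]; apply/is_formP.
  by move=> *; rewrite mulr0 addr0.
move=> s u v.
rewrite -![(r *: a + b) _]/(r * a _ + b _) la lb !mulrDr !mulrA (mulrC s r).
by rewrite addrACA.
Qed.

End Dual.

HB.instance Definition _ (R : realType) (V : lmodType R) :=
  GRing.isSubmodClosed.Build R (V -> R) (is_form V) (@is_form_submod R V).
HB.instance Definition _ (R : realType) (V : lmodType R) :=
  [isSub for @dual_val R V].
HB.instance Definition _ (R : realType) (V : lmodType R) :=
  [Choice of dual V by <:].
HB.instance Definition _ (R : realType) (V : lmodType R) :=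
  [SubChoice_isSubLmodule of dual V by <:].

Section Transpose.
Context {R : realType} {V W : lmodType R}.

Fact transpose_subproof (u : {linear V -> W}) (a : dual W) :
  (fun v => a (u v)) \in is_form V.
Proof.
have /is_formP la := dualP a; apply/is_formP => r v w.
by rewrite linearP la.
Qed.

Definition transpose (u : {linear V -> W}) (a : dual W) : dual V :=
  Dual (transpose_subproof u a).

End Transpose.

Section Fibration.
Context {R : realType} {n : nat} {Q : manifoldType R n}.

Definition cotangent (q : Q) := dual (tangent q).

Fact eta_subproof (Pi : smooth_fun Q) (q : Q) :
  (fun v : tangent q => v Pi) \in is_form (tangent q).
Proof. exact/is_formP. Qed.

(** [eta = Pi^*(dt)]: a derivation [v] is pushed to [dt (T Pi v) = v (t \o Pi)]. *)
Definition eta_form (Pi : smooth_fun Q) (q : Q) : cotangent q :=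
  Dual (eta_subproof Pi q).

(** Surjective submersion; [T_q Pi] is [eta_form Pi q] under [T_t R = R]. *)
Definition fibration (Pi : smooth_fun Q) : Prop :=
  (forall t : R, exists q, Pi q = t) /\
  (forall (q : Q) (s : R), exists v, eta_form Pi q v = s).

Definition is_vertical (Pi : smooth_fun Q) (q : Q) : {pred tangent q} :=
  fun v => eta_form Pi q v == 0.
Arguments is_vertical Pi q : clear implicits.

Record vertical (Pi : smooth_fun Q) (q : Q) := Vertical {
  vertical_val :> tangent q ;
  verticalP : vertical_val \in is_vertical Pi q }.

Fact is_vertical_submod (Pi : smooth_fun Q) (q : Q) :
  submod_closed (is_vertical Pi q).
Proof.
have /is_formP l := dualP (eta_form Pi q).
split=> [|r u v]; first by rewrite unfold_in.
by rewrite !unfold_in l => /eqP -> /eqP ->; rewrite mulr0 addr0.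
Qed.

HB.instance Definition _ (Pi : smooth_fun Q) (q : Q) :=
  GRing.isSubmodClosed.Build R (tangent q) (is_vertical Pi q)
    (is_vertical_submod Pi q).
HB.instance Definition _ (Pi : smooth_fun Q) (q : Q) :=
  [isSub for @vertical_val Pi q].
HB.instance Definition _ (Pi : smooth_fun Q) (q : Q) :=
  [Choice of vertical Pi q by <:].
HB.instance Definition _ (Pi : smooth_fun Q) (q : Q) :=
  [SubChoice_isSubLmodule of vertical Pi q by <:].

Definition vdual (Pi : smooth_fun Q) (q : Q) := dual (vertical Pi q).

Definition mu (Pi : smooth_fun Q) (q : Q) : cotangent q -> vdual Pi q :=
  transpose (val : {linear vertical Pi q -> tangent q}).

End Fibration.
Arguments is_vertical {R n Q} Pi q.

Section Bundles.
Context {R : realType} {n : nat} {Q : manifoldType R n.+1}.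

(** Natural coordinates [(q^i, p_i)]. *)
Definition cot_chart (c : chart R n.+1 Q)
  : chart R (n.+1 + n.+1) {q : Q & cotangent q} :=
  {| cdom := [set x | cdom c (tag x)] ;
     cval := fun x => row_mx (c (tag x))
       (\row_(i < n.+1) (tagged x : cotangent (tag x)) (coord_vec c (tag x) i)) |}.

Definition cot_atlas : set (chart R (n.+1 + n.+1) {q : Q & cotangent q}) :=
  [set cot_chart c | c in max_atlas Q].

(** Charts whose first coordinate is [Pi]. *)
Definition adapted (Pi : smooth_fun Q) : set (chart R n.+1 Q) :=
  [set c | max_atlas Q c /\ forall q, cdom c q -> c q 0 ord0 = Pi q].

(** Natural coordinates [(t, q^i, p_i)] in an adapted chart, where the vectors
    [d/dq^i] are vertical ([coord_vec_vertical]), so that [insubd] merely sees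
    them in [vertical Pi q]. *)
Definition vdual_chart (Pi : smooth_fun Q) (c : chart R n.+1 Q)
  : chart R (n.+1 + n) {q : Q & vdual Pi q} :=
  {| cdom := [set x | cdom c (tag x)] ;
     cval := fun x => row_mx (c (tag x))
       (\row_(i < n) (tagged x : vdual Pi (tag x))
          (insubd (0 : vertical Pi (tag x)) (coord_vec c (tag x) (lift ord0 i)))) |}.

Definition vdual_atlas (Pi : smooth_fun Q)
  : set (chart R (n.+1 + n) {q : Q & vdual Pi q}) :=
  [set vdual_chart Pi c | c in adapted Pi].
Arguments vdual_atlas Pi : clear implicits.

Lemma coord_vec_vertical (Pi : smooth_fun Q) (c : chart R n.+1 Q) (q : Q)
    (i : 'I_n) : adapted Pi c -> cdom c q ->
  coord_vec c q (lift ord0 i) \in is_vertical Pi q.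
Proof.
move=> [Mc cPi] cq; rewrite unfold_in /= coord_vecE //.
have [cc _] := Mc; have [_ ic _ _] := cc.
have nV : \forall x \near c q, (c @` cdom c) x.
  by apply: open_nbhs_nbhs; split; [exact: is_chart_img|exists q].
have nE : \forall x \near c q, (x : 'rV[R]_n.+1) 0 ord0 = via c Pi x.
  by apply: filterS nV => _ [p cp <-]; rewrite viaE // cPi.
rewrite (near_diff nE _).2; first by rewrite diff_coordE mxE.
exact: differentiable_coord.
Qed.

(** As [mu] covers the identity of [Q], a section of [mu] is a family of sections
    of the [mu q]. *)
Record ham_section (Pi : smooth_fun Q) := HamSection {
  hamS :> forall q : Q, vdual Pi q -> cotangent q ;
  hamS_section : forall q (beta : vdual Pi q), mu Pi (hamS beta) = beta ;
  hamS_smooth : smooth_wrt (vdual_atlas Pi) cot_atlas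
    (fun x : {q : Q & vdual Pi q} => existT _ (tag x) (hamS (tagged x))) }.

(** The function [F_h]; see [ham_funP] and [ham_fun_uniq]. *)
Definition ham_fun (Pi : smooth_fun Q) (h : ham_section Pi) (q : Q)
    (alpha : cotangent q) : R :=
  xget 0 [set s | alpha - h q (mu Pi alpha) = s *: eta_form Pi q].

Lemma ham_funP (Pi : smooth_fun Q) (h : ham_section Pi) (q : Q)
    (alpha : cotangent q) : fibration Pi ->
  alpha - h q (mu Pi alpha) = ham_fun h alpha *: eta_form Pi q.
Proof.
move=> [_ /(_ q 1)[u0 u01]]; rewrite /ham_fun; case: xgetP => [s _ //|noS].
set d := alpha - _ in noS *; exfalso; apply: (noS (d u0)).
have /is_formP ld := dualP d.
have /is_formP le := dualP (eta_form Pi q).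
apply: val_inj; apply/funext => u /=.
rewrite -[RHS]/(d u0 * eta_form Pi q u).
have wV : - eta_form Pi q u *: u0 + u \in is_vertical Pi q.
  by rewrite unfold_in le u01 mulr1 addNr.
have : d (- eta_form Pi q u *: u0 + u) = 0.
  have /(congr1 (fun b : vdual Pi q => b (Vertical wV))) :=
    hamS_section h (mu Pi alpha).
  rewrite /= => E; rewrite -[LHS]/(alpha _ - (h q (mu Pi alpha)) _).
  by rewrite E subrr.
by rewrite ld mulNr => /eqP; rewrite addrC subr_eq0 mulrC => /eqP.
Qed.

Lemma ham_fun_uniq (Pi : smooth_fun Q) (h : ham_section Pi) (q : Q)
    (alpha : cotangent q) (s : R) : fibration Pi ->
  alpha - h q (mu Pi alpha) = s *: eta_form Pi q -> ham_fun h alpha = s.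
Proof.
move=> fPi; rewrite (ham_funP h alpha fPi) => E.
have [_ /(_ q 1)[u0 u01]] := fPi.
have := congr1 (fun b : cotangent q => b u0) E.
by rewrite -![(_ *: eta_form Pi q) _]/(_ * eta_form Pi q u0) u01 !mulr1.
Qed.

End Bundles.
Arguments adapted {R n Q} Pi.
Arguments vdual_atlas {R n Q} Pi.

Record lie_action (R : realType) m n (G : lieGroupType R m)
    (Q : manifoldType R n) := LieAction {
  act :> G -> Q -> Q ;
  act1 : forall q, act 1%g q = q ;
  actM : forall g g' q, act (g * g')%g q = act g (act g' q) ;
  act_smooth2 : smooth_wrt (prod_atlas (@atlas R m G) (@atlas R n Q))
    (@atlas R n Q) (fun x => act x.1 x.2) }.

Section Action.
Context {R : realType} {m n : nat} {G : lieGroupType R m} {Q : manifoldType R n}.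
Variable phi : lie_action G Q.

Lemma act_smooth (g : G) : smooth_map (phi g).
Proof.
move=> a b Aa Ab; have [_ ia _ _] := atlas_chart a Aa.
have [c Ac cg] := atlas_cover g; have [_ ic _ _] := atlas_chart c Ac.
have Aca : prod_atlas (@atlas R m G) (@atlas R n Q) (prod_chart c a).
  by exists c => //; exists a.
pose P := prod_chart c a @`
  (cdom (prod_chart c a) `&` (fun x => phi x.1 x.2) @^-1` cdom b).
pose W := a @` (cdom a `&` phi g @^-1` cdom b).
have [oP sP] : open P /\ Coo_vec P _ := @act_smooth2 _ _ _ _ _ phi _ _ Aca Ab.
pose iota (x : 'rV[R]_n) : 'rV[R]_(m + n) := row_mx (c g) x.
have WP : W = iota @^-1` P.
  apply/seteqP; split=> [_ [q [aq bq] <-]|x [[g' q] [[cg' aq] bq]]].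
    by exists (g, q).
  move=> /eq_row_mx[/= cE <-]; exists q => //; split=> //.
  by rewrite /= -(ic g' g) ?inE.
have Ci (U : set 'rV[R]_n) : Coo_vec U iota.
  move=> i k; rewrite /iota; case: (splitP i) => j ij.
    rewrite (_ : (fun x => _) = fun=> c g 0 j); first exact: Ck_cst.
    apply/funext => x; rewrite (_ : i = lshift n j) ?row_mxEl //.
    exact: val_inj.
  rewrite (_ : (fun x => _) = fun x : 'rV[R]_n => x 0 j); first exact: Ck_coord.
  apply/funext => x; rewrite (_ : i = rshift m j) ?row_mxEr //.
  exact: val_inj.
have oW : open W.
  rewrite WP; apply: open_comp => // x _.
  apply: differentiable_continuous; apply: (diff_coords _).1 => i.
  by have [D _] := Ci setT i 1%N; exact: D.
split=> // i k.
have H := Coo_comp oW (Ci W) (W := P) _ (sP i).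
apply: Ck_ext oW _ (H _ k) => [_ [q [aq bq] <-]|x]; last by rewrite WP.
rewrite (viaE _ ia aq) -[iota (a q)]/(prod_chart c a (g, q)) viaE //.
move=> [g1 q1] [g2 q2]; rewrite !inE => -[/= ? ?] [/= ? ?].
by move=> /eq_row_mx[cE aE]; rewrite (ic g1 g2) ?inE // (ia q1 q2) ?inE.
Qed.

Lemma actVK (g : G) (q : Q) : phi g^-1%g (phi g q) = q.
Proof. by rewrite -actM mulVg act1. Qed.

(** [phi_g^* eta = eta] for all [g]. *)
Definition eta_invariant (Pi : smooth_fun Q) : Prop :=
  forall (g : G) (q : Q) (u : tangent q),
    eta_form Pi (phi g q) (tmap (act_smooth g) (erefl (phi g q)) u) = eta_form Pi q u.

(** [T^*_g phi (alpha) = alpha \o T_(phi_g q) phi_(g^-1)]. *)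
Definition cot_lift (g : G) (q : Q) : cotangent q -> cotangent (phi g q) :=
  transpose (tmap (act_smooth g^-1%g) (actVK g q)).

Section Vertical.
Variables (Pi : smooth_fun Q) (inv : eta_invariant Pi).

Fact vtmap_subproof (g : G) (p q : Q) (e : phi g p = q) (u : vertical Pi p) :
  tmap (act_smooth g) e u \in is_vertical Pi q.
Proof. by case: q / e; rewrite unfold_in inv; exact: verticalP. Qed.

(** The restriction of [T phi_g] to the vertical bundle. *)
Definition vtmap (g : G) (p q : Q) (e : phi g p = q) (u : vertical Pi p)
  : vertical Pi q := Vertical (vtmap_subproof e u).

Fact vtmap_is_linear (g : G) (p q : Q) (e : phi g p = q) : linear (vtmap e).
Proof. by move=> r u v; apply: val_inj; rewrite /= linearP. Qed.

HB.instance Definition _ (g : G) (p q : Q) (e : phi g p = q) :=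
  GRing.isLinear.Build R (vertical Pi p) (vertical Pi q) _ (vtmap e)
    (vtmap_is_linear e).

(** [V^*_g phi (beta) = beta \o T_(phi_g q) phi_(g^-1)] on vertical vectors. *)
Definition vdual_lift (g : G) (q : Q) : vdual Pi q -> vdual Pi (phi g q) :=
  transpose (vtmap (actVK g q)).

End Vertical.
End Action.

(* Main.v *)
(** Invariance of [eta] makes [T^*phi] commute with the principal action
    [psi(s, alpha) = alpha + s eta], and [mu] intertwines [T^*phi] with [V^*phi].
    Applying [T_g^*phi] to [alpha - h (mu alpha) = F_h(alpha) eta] therefore turns
    equivariance of [h] into invariance of [F_h]; conversely the image of [h] is
    the zero set of [F_h], so invariance of [F_h] makes this image invariant. *)
From HB Require Import structures.
Require Import Defs.
From mathcomp Require Import all_boot all_order all_algebra.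
From mathcomp Require Import all_classical all_reals.
From mathcomp Require Import topology normedtype landau derive.
Local Open Scope classical_set_scope.
Local Open Scope ring_scope.

Import GRing.Theory.

Section LiftedActions.
Context {R : realType} {n m : nat} {G : lieGroupType R m} {Q : manifoldType R n}.
Implicit Types (phi : lie_action G Q) (Pi : smooth_fun Q) (g : G) (q : Q).

Lemma cot_lift_is_linear phi g q : linear (@cot_lift _ _ _ _ _ phi g q).
Proof. by move=> r a b; apply: val_inj. Qed.

HB.instance Definition _ phi g q :=
  GRing.isLinear.Build R (cotangent q) (cotangent (phi g q)) _
    (@cot_lift _ _ _ _ _ phi g q) (cot_lift_is_linear phi g q).

Lemma cot_lift_eta phi Pi g q : eta_invariant phi Pi ->
  cot_lift phi g (eta_form Pi q) = eta_form Pi (phi g q).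
Proof.
move=> inv; apply: val_inj; apply/funext => u.
(* Invariance for [g^-1] at [phi g q]; it lands over [phi g^-1 (phi g q)] rather than [q], but the
   value of [eta_form] on a derivation, [v Pi], does not mention the base point. *)
exact: inv g^-1%g (phi g q) u.
Qed.

Lemma mu_cot_lift phi Pi (inv : eta_invariant phi Pi) g q (alpha : cotangent q) :
  mu Pi (cot_lift phi g alpha) = vdual_lift inv g (mu Pi alpha).
Proof. exact: val_inj. Qed.

End LiftedActions.

(** As [h] is a section, [h q beta] equals [h] of its own projection, so their difference is
    [0 *: eta]. *)
Lemma ham_fun_image (R : realType) (n : nat) (Q : manifoldType R n.+1)
    (Pi : smooth_fun Q) (h : ham_section Pi) (q : Q) (beta : vdual Pi q) :
  fibration Pi -> ham_fun h (h q beta) = 0.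
Proof.
by move=> fPi; apply: ham_fun_uniq => //; rewrite hamS_section subrr scale0r.
Qed.

Theorem proposition3p5 (R : realType) (n m : nat)
    (Q : manifoldType R n.+1) (Q_connected : connected [set: Q])
    (Pi : smooth_fun Q) (Pi_fibration : fibration Pi)
    (G : lieGroupType R m) (phi : lie_action G Q)
    (eta_inv : eta_invariant phi Pi) (h : ham_section Pi) :
  (forall (g : G) (q : Q) (beta : vdual Pi q),
     cot_lift phi g (h q beta) = h (phi g q) (vdual_lift eta_inv g beta)) <->
  (forall (g : G) (q : Q) (alpha : cotangent q),
     ham_fun h (cot_lift phi g alpha) = ham_fun h alpha).
Proof.
split=> [equiv g q alpha|invar g q beta].
  apply: ham_fun_uniq => //.
  rewrite (mu_cot_lift _ _ eta_inv) -equiv -(cot_lift_eta _ _ _ _ eta_inv).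
  by rewrite -linearB -linearZ ham_funP.
(* Zero coefficient here says that the lifted covector is [h] of its projection. *)
have := ham_funP h (cot_lift phi g (h q beta)) Pi_fibration.
rewrite invar ham_fun_image // scale0r (mu_cot_lift _ _ eta_inv) hamS_section.
by move/eqP; rewrite subr_eq0 => /eqP.
Qed.
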